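(* Let $p\ge5$ be a prime. For $c\in\{8,16,-16,32\}$, consider the Vieta graph of the quartic $(x+y+z+t+1)^2=cxyzt$ over $\mathbb{F}_p$. (a) If $c=8$: there are $p^3-1+\sigma(2)\varphi_2(1)p$ vertices in total; there are $4\big(p-3-\sigma(-1)\big)^2$ vertices of degree $3$, $6\big(1+\sigma(-1)\big)(p-3)$ of degree $2$, $4\big(p^2-3p+4+\sigma(-1)\big)$ of degree $1$, and $6p-8$ of degree $0$. (b) If $c=16$: there are $p^3-1-\sigma(-1)p$ vertices in total; there are $4(p-3)^2$ vertices of degree $3$, $6(p-2)$ of degree $2$, $4(p^2-3p+3)$ of degree $1$, and $6p-7$ of degree $0$. (c) If $c=-16$: there are $p^3-1+\sigma(2)\varphi_2(1)p$ vertices in total; there are $4\big(p-3-\sigma(2)\big)^2$ vertices of degree $3$, $6\big(1+\sigma(2)\big)(p-3)$ of degree $2$, $4\big(p^2-3p+4+\sigma(2)\big)$ of degree $1$, and $6p-8$ of degree $0$. (d) If $c=32$: there are $p^3-1+\varphi_2(1)p$ vertices in total; there are $4\big(p-3-\sigma(2)\big)^2$ vertices of degree $3$, $6\big(1+\sigma(2)\big)(p-3)$ of degree $2$, $4\big(p^2-3p+4+\sigma(2)\big)$ of degree $1$, and $6p-8$ of degree $0$.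
   Context: $\sigma:\mathbb{F}_p\to\{-1,0,1\}\subset\mathbb{Z}$ denotes the quadratic character: $\sigma(a)=1$ if $a$ is a nonzero square, $\sigma(a)=-1$ if $a$ is a non-square, $\sigma(0)=0$. The Jacobsthal sum is $\varphi_2(1)=\sum_{x\in\mathbb{F}_p}\sigma(x^3+x)$. Let $f(x_1,x_2,x_3,x_4)=(x_1+x_2+x_3+x_4+1)^2-c\,x_1x_2x_3x_4$, which is monic quadratic in each variable. The $i$-th Vieta flip of a solution $x=(x_1,\dots,x_4)\in\mathbb{F}_p^4$ of $f=0$ is the solution obtained by replacing $x_i$ by the other root $x_i'=x_i-(\partial_i f)(x)$ of $f=0$ viewed as a quadratic equation in $x_i$. The Vieta graph is the finite simple graph whose vertices are the solutions of $f=0$ in $\mathbb{F}_p^4$, where two distinct vertices are joined by an edge whenever one is a Vieta flip of the other. *)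

(* Defs.v *)
From mathcomp Require Import all_boot all_order all_algebra.
From mathcomp Require Import mpoly.

Set Implicit Arguments.
Unset Strict Implicit.
Unset Printing Implicit Defensive.

Import GRing.Theory.
Local Open Scope ring_scope.

Definition quad_char (F : finFieldType) (a : F) : int :=
  if a == 0 then 0 else if [exists b : F, a == b ^+ 2] then 1 else -1.

Definition jacobsthal2_1 (p : nat) : int :=
  \sum_(x : 'F_p) quad_char (x ^+ 3 + x).

Section VietaGraph.
Variables (F : finFieldType) (c : F).

Definition vieta_poly : {mpoly F[4]} :=
  ((\sum_(i < 4) 'X_i) + 1) ^+ 2 - c *: \prod_(i < 4) 'X_i.

Definition vieta_vertices : {set {ffun 'I_4 -> F}} :=
  [set x : {ffun 'I_4 -> F} | vieta_poly.@[x] == 0].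

Definition vieta_flip (i : 'I_4) (x : {ffun 'I_4 -> F}) : {ffun 'I_4 -> F} :=
  [ffun j => if j == i then x i - (vieta_poly^`M(i)).@[x] else x j].

Definition vieta_adj : rel {ffun 'I_4 -> F} := fun x y =>
  (x != y) && [exists i, (y == vieta_flip i x) || (x == vieta_flip i y)].

Definition vieta_degree (x : {ffun 'I_4 -> F}) : nat :=
  #|[set y in vieta_vertices | vieta_adj x y]|.

Definition vieta_ndeg (d : nat) : nat :=
  #|[set x in vieta_vertices | vieta_degree x == d]|.

End VietaGraph.

(* Main.v *)
Require Import Defs.
From mathcomp Require Import all_boot all_order all_algebra all_fingroup.
From mathcomp Require Import mpoly.
From mathcomp Require Import ring zify.

Set Implicit Arguments.
Unset Strict Implicit.
Unset Printing Implicit Defensive.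

Import Order.TTheory GRing.Theory Num.Theory.
Local Open Scope ring_scope.

(** With S = x + y + z + t + 1, the i-th flip fixes a solution exactly when the i-th
    partial derivative vanishes there, and flips in distinct coordinates give distinct
    neighbours, so the degree is the number of nonvanishing partial derivatives. If S != 0
    the i-th one vanishes iff 2 x_i = S; if S = 0 some coordinate is 0 and it vanishes iff
    the product of the other coordinates does. By symmetry it suffices to count the
    solutions whose moving flips are exactly the first k ones; these counts only involve
    the roots of w^2 + w + 4/c, whose number is 1 + quad_char (1 - 16/c).

    For the number of vertices, solving for t and then summing over z and y leaves the
    character sum of a cubic w (w^2 + (c/4 - 2) w + 1). For the given values of c it is
    either degenerate or related by a 2-isogeny to the sum of x^3 + x. *)

Lemma natr4_neq0 (K : idomainType) : (2 : K) != 0 -> (4 : K) != 0.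
Proof. by move=> two_neq0; have := mulf_neq0 two_neq0 two_neq0; rewrite -natrM. Qed.

Lemma complete_square (K : fieldType) (a b y : K) : (2 : K) != 0 ->
  ((y - a) / 2) ^+ 2 + a * ((y - a) / 2) + b
  = (y ^+ 2 - (a ^+ 2 - 4 * b)) / 2 ^+ 2.
Proof.
by move=> two_neq0; field; rewrite two_neq0 natr4_neq0.
Qed.

(** * Character sums of the quadratic character *)

Section QuadraticCharacter.

Variable F : finFieldType.
Hypothesis two_neq0 : (2 : F) != 0.
Implicit Types a b e x y : F.

Lemma quad_char0 : quad_char (0 : F) = 0.
Proof. by rewrite /quad_char eqxx. Qed.

Lemma quad_char_sqr x : x != 0 -> quad_char (x ^+ 2) = 1.
Proof.
move=> x0; rewrite /quad_char sqrf_eq0 (negbTE x0).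
by case: existsP => // -[]; exists x.
Qed.

Lemma quad_char1 : quad_char (1 : F) = 1.
Proof. by rewrite -[1](expr1n F 2) quad_char_sqr ?oner_neq0. Qed.

Lemma sum_sqrt a : \sum_(y : F | y ^+ 2 == a) 1 = 1 + quad_char a.
Proof.
rewrite /quad_char; case: (eqVneq a 0) => [->|a0].
  rewrite (big_pred1 0) ?addr0 // => y; exact: sqrf_eq0.
case: existsP => [[b /eqP ab]|nsq]; last first.
  by rewrite big_pred0 => [|y]; [rewrite subrr |
    apply/negP => /eqP ya; case: nsq; exists y; rewrite ya].
have b0 : b != 0 by apply: contraNneq a0 => b0; rewrite ab b0 expr0n.
have bN : - b != b by rewrite eq_sym -subr_eq0 opprK -mulr2n -mulr_natl mulf_neq0.
rewrite (bigD1 b) ?ab //= (big_pred1 (- b)) // => y.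
rewrite eqf_sqr; case: (eqVneq y b) => [->|_] /=; last by rewrite andbT.
by rewrite eq_sym (negbTE bN).
Qed.

Lemma sum_quadratic_roots a b :
  \sum_(t : F | t ^+ 2 + a * t + b == 0) 1 = 1 + quad_char (a ^+ 2 - 4 * b).
Proof.
rewrite -sum_sqrt (reindex (fun y => (y - a) / 2)) /=; last first.
  by exists (fun t => 2 * t + a) => t _ /=; field; exact: two_neq0.
apply: eq_bigl => y; rewrite complete_square // mulf_eq0 subr_eq0 invr_eq0.
by rewrite expf_eq0 /= (negbTE two_neq0) orbF.
Qed.

(** Summing 1 + [quad_char x] over x counts the pairs (x, y) with y^2 = x, and each y occurs in
    exactly one of them. *)
Lemma sum_quad_char : \sum_(x : F) quad_char x = 0 :> int.
Proof.
apply: (addrI (\sum_(x : F) (1 : int))); rewrite -big_split addr0 /=.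
under eq_bigr do rewrite -sum_sqrt big_mkcond /=.
rewrite exchange_big /=; apply: eq_bigr => y _.
rewrite -big_mkcond /= (big_pred1 (y ^+ 2)) // => x; exact: eq_sym.
Qed.

Lemma quad_char_le1 x : quad_char x <= 1.
Proof. by rewrite /quad_char; case: ifP => // _; case: ifP. Qed.

Lemma quad_char_neq0 x : x != 0 -> quad_char x = 1 \/ quad_char x = -1.
Proof. by rewrite /quad_char => /negbTE ->; case: ifP; [left | right]. Qed.

Lemma quad_char_square x : quad_char x = 1 -> exists2 y, y != 0 & x = y ^+ 2.
Proof.
rewrite /quad_char; case: (eqVneq x 0) => // x0.
case: existsP => // -[y /eqP xy] _; exists y => //.
by apply: contraNneq x0 => y0; rewrite xy y0 expr0n.
Qed.

Lemma quad_char_sqrM x y : x != 0 -> quad_char (x ^+ 2 * y) = quad_char y.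
Proof.
move=> x0; rewrite /quad_char mulf_eq0 sqrf_eq0 (negbTE x0) /=; case: ifP => // _.
congr (if _ then _ else _); apply/existsP/existsP => -[b /eqP e].
  by exists (b / x); rewrite expr_div_n -e mulrC mulKf // expf_neq0.
by exists (x * b); rewrite e exprMn.
Qed.

(* For a nonsquare a, the terms quad_char (a x) + quad_char x are all <= 0 while
   their sum over x vanishes. *)
Lemma quad_charM a x : quad_char (a * x) = quad_char a * quad_char x.
Proof.
case: (eqVneq a 0) => [->|a0]; first by rewrite mul0r quad_char0 mul0r.
case: (quad_char_neq0 a0) => sa.
  by have [y y0 ->] := quad_char_square sa; rewrite quad_char_sqrM // quad_char_sqr // mul1r.
rewrite sa mulN1r.
have le0 y : 0 <= - (quad_char (a * y) + quad_char y).
  case: (eqVneq y 0) => [->|y0]; first by rewrite mulr0 quad_char0.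
  case: (quad_char_neq0 y0) => sy; last by rewrite sy; have := quad_char_le1 (a * y); lia.
  have [z z0 yz] := quad_char_square sy.
  by rewrite {1}yz mulrC quad_char_sqrM // sa sy.
have sum0 : \sum_(y : F) - (quad_char (a * y) + quad_char y) = 0.
  rewrite sumrN big_split /= sum_quad_char addr0; apply/eqP; rewrite oppr_eq0; apply/eqP.
  by have := sum_quad_char; rewrite (reindex_inj (mulfI a0)) /= => ->.
have := psumr_eq0P (fun y _ => le0 y) sum0; move=> /(_ x isT) /eqP.
by rewrite oppr_eq0 addr_eq0 => /eqP.
Qed.

Lemma quad_charV x : quad_char x^-1 = quad_char x.
Proof.
case: (eqVneq x 0) => [->|x0]; first by rewrite invr0.
by rewrite -(quad_char_sqrM x^-1 x0) expr2 mulfK.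
Qed.

Lemma quad_char_mulss x : x != 0 -> quad_char x * quad_char x = 1.
Proof. by move=> x0; rewrite -quad_charM -expr2 quad_char_sqr. Qed.

Lemma sum_quad_char_affine a b : a != 0 -> \sum_(x : F) quad_char (a * x + b) = 0.
Proof.
move=> a0; have := sum_quad_char; rewrite (reindex (fun x => a * x + b)) //.
by exists (fun y => (y - b) / a) => y _ /=; field.
Qed.

(** Replacing a nonzero x by 1/x and multiplying by the square x^2 turns the argument into a - b x.
    The sum of this affine form over all x is 0, so the absent term at x = 0 leaves -
    [quad_char a]. *)
Lemma sum_quad_char_quadratic a b : b != 0 ->
  \sum_(x : F) quad_char (a * x ^+ 2 - b * x) = - quad_char a.
Proof.
move=> b0; rewrite (bigD1 0) //= expr0n !mulr0 subr0 quad_char0 add0r.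
rewrite (reindex_inj invr_inj) /=.
have bN0 : - b != 0 by rewrite oppr_eq0.
have := sum_quad_char_affine a bN0.
rewrite (bigD1 0) //= mulr0 add0r => /eqP; rewrite addrC addr_eq0 => /eqP <-.
apply: eq_big => x; first by rewrite invr_eq0.
rewrite invr_eq0 => x0; rewrite -[LHS](quad_char_sqrM _ x0).
by congr quad_char; field.
Qed.

(** The fibre of x + b/x over t consists of the roots of x^2 - t x + b, and 0 is never a root
    because b != 0. *)
Lemma sum_quad_char_hyperbola a b : b != 0 ->
  \sum_(x : F | x != 0) quad_char (x + b / x + a)
  = \sum_(t : F) (1 + quad_char (t ^+ 2 - 4 * b)) * quad_char (t + a).
Proof.
move=> b0.
under [RHS]eq_bigr => t _.
  have -> : 1 + quad_char (t ^+ 2 - 4 * b) = \sum_(x : F | x ^+ 2 + - t * x + b == 0) 1.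
    by rewrite sum_quadratic_roots sqrrN.
  rewrite big_distrl /=; under eq_bigr do rewrite mul1r; over.
rewrite (exchange_big_dep predT) //= [RHS](bigID (fun x => x != 0)) /=.
rewrite [X in _ = _ + X]big1 => [|x]; last first.
  rewrite negbK => /eqP ->; rewrite big_pred0 // => t.
  by rewrite expr0n mulr0 !add0r (negbTE b0).
rewrite addr0; apply: eq_bigr => x x0; rewrite (big_pred1 (x + b / x)) // => t.
have -> : x ^+ 2 + - t * x + b = (x + b / x - t) * x by field.
by rewrite mulf_eq0 (negbTE x0) orbF subr_eq0 eq_sym.
Qed.

(* The 2-isogeny invariance of the point count: for x != 0 the cubic is x^2 (x + b/x + a),
   and t = x + b/x is attained 1 + quad_char (t^2 - 4 b) times. *)
Lemma sum_quad_char_isogeny a b : b != 0 ->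
  \sum_(x : F) quad_char (x * (x ^+ 2 + a * x + b))
  = \sum_(x : F) quad_char (x * (x ^+ 2 - 2 * a * x + (a ^+ 2 - 4 * b))).
Proof.
move=> b0; rewrite (bigD1 0) //= mul0r quad_char0 add0r.
transitivity (\sum_(x : F | x != 0) quad_char (x + b / x + a)).
  apply: eq_bigr => x x0; rewrite -[RHS](quad_char_sqrM _ x0).
  by congr quad_char; field.
rewrite sum_quad_char_hyperbola //.
under [LHS]eq_bigr do rewrite mulrDl mul1r.
rewrite big_split /=; have -> : \sum_(t : F) quad_char (t + a) = 0.
  by have := sum_quad_char_affine a (oner_neq0 F); under eq_bigr do rewrite mul1r.
rewrite add0r.
rewrite [RHS](reindex (fun t => t + a)) /=; last first.
  by exists (fun t => t - a) => t _; rewrite ?addrK ?subrK.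
by apply: eq_bigr => t _; rewrite -quad_charM; congr quad_char; ring.
Qed.

End QuadraticCharacter.

(** * Counting tuples up to permutation of the coordinates *)

Section PermutationSymmetry.

Variables (n : nat) (T : finType).

Definition permute (s : {perm 'I_n}) (x : {ffun 'I_n -> T}) : {ffun 'I_n -> T} :=
  [ffun i => x (s i)].

Lemma permute_inj s : injective (permute s).
Proof.
move=> x y /ffunP exy; apply/ffunP => i.
by have := exy ((s^-1)%g i); rewrite !ffunE permKV.
Qed.

(** Transposing an element of A outside B with an element of B outside A shrinks the difference of A
    and B, which gives the induction. *)
Lemma perm_imset_card (A B : {set 'I_n}) :
  #|A| = #|B| -> exists s : {perm 'I_n}, s @: A = B.
Proof.
have [m] := ubnP #|A :\: B|; elim: m A => // m IH A ltm eAB.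
case: (set_0Vmem (A :\: B)) => [D0|[a aD]].
  exists 1%g; apply/eqP; rewrite eqEcard card_imset; last exact: perm_inj.
  rewrite eAB leqnn andbT; apply/subsetP => _ /imsetP[x xA ->]; rewrite perm1.
  by move/setP/(_ x): D0; rewrite !inE xA andbT => /negbFE.
have [b bD] : exists b, b \in B :\: A.
  apply/set0Pn; rewrite -card_gt0 cardsD setIC -eAB -cardsD card_gt0.
  by apply/set0Pn; exists a.
move: aD bD; rewrite !inE => /andP[aB aA] /andP[bA bB].
have memA y : (y \in tperm a b @: A) = (tperm a b y \in A).
  by rewrite -{1}(tpermK a b y) mem_imset //; exact: perm_inj.
have [||s es] := IH (tperm a b @: A).
- rewrite -ltnS; apply: leq_trans ltm; rewrite ltnS; apply: proper_card; apply/properP; split.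
    apply/subsetP => y; rewrite !inE memA => /andP[yB]; rewrite yB /=.
    by case: tpermP yB => // -> ; rewrite ?bB.
  by exists a; rewrite !inE ?aB // memA tpermL (negbTE bA) andbF.
- by rewrite card_imset //; exact: perm_inj.
exists (tperm a b * s)%g; rewrite -es -imset_comp.
by apply: eq_imset => x; rewrite /= permM.
Qed.

(** If s maps A onto B, then [permute s] maps the tuples with [D x = B] bijectively to those with
    [D x = A]. Hence all fibres of D over sets of size [#|A|] have the same cardinality. *)
Lemma card_permute_invariant (P : pred {ffun 'I_n -> T})
    (D : {ffun 'I_n -> T} -> {set 'I_n}) (A : {set 'I_n}) :
    (forall s x, P (permute s x) = P x) ->
    (forall s x i, (i \in D (permute s x)) = (s i \in D x)) ->
  #|[set x | P x & #|D x| == #|A|]| = ('C(n, #|A|) * #|[set x | P x & D x == A]|)%N.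
Proof.
move=> permP permD; rewrite -sum1dep_card.
rewrite (partition_big D (fun B => #|B| == #|A|)) /=; last by move=> x /andP[].
transitivity (\sum_(B : {set 'I_n} | #|B| == #|A|) #|[set x | P x & D x == A]|)%N; last first.
  by rewrite sum_nat_const -[X in 'C(X, _)]card_ord -card_draws; congr muln;
    apply: eq_card => B; rewrite inE.
apply: eq_bigr => B /eqP eBA; rewrite sum1dep_card.
have [s es] := perm_imset_card (esym eBA).
rewrite -[RHS](card_preimset _ (@permute_inj s)); apply: eq_card => x.
rewrite !inE permP -andbA; congr (_ && _).
apply/andP/eqP => [[_ /eqP DB]|DA].
  by apply/setP => i; rewrite permD DB -es mem_imset //; exact: perm_inj.
suff -> : D x = B by rewrite eqxx eBA.
by apply/setP => i; rewrite -(permKV s i) -permD DA -es mem_imset //; exact: perm_inj.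
Qed.

End PermutationSymmetry.

(** * Degrees as numbers of nonvanishing partial derivatives *)

Section VietaDegree.

Variables (F : finFieldType) (c : F).
Local Notation V := (vieta_vertices c).
Implicit Types (x y : {ffun 'I_4 -> F}) (i : 'I_4).

(** The value of the i-th partial derivative of [vieta_poly], free of formal polynomials; see
    [vieta_deriv_eval]. *)
Definition vieta_deriv i x : F :=
  2 * (\sum_j x j + 1) - c * \prod_(j | j != i) x j.

Definition moving_flips x : {set 'I_4} := [set i | vieta_deriv i x != 0].

Lemma vieta_poly_eval x :
  (vieta_poly c).@[x] = (\sum_j x j + 1) ^+ 2 - c * \prod_j x j.
Proof.
rewrite /vieta_poly mevalB rmorphXn /= mevalD meval1 mevalZ.
rewrite rmorph_sum rmorph_prod /=.
by under eq_bigr do rewrite mevalXU; under [in X in _ - X]eq_bigr do rewrite mevalXU.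
Qed.

Lemma mderiv_prodX (P : pred 'I_4) i :
  ~~ P i -> (\prod_(j | P j) 'X_j : {mpoly F[4]})^`M(i) = 0.
Proof.
move=> Pi; apply: (big_ind (fun p : {mpoly F[4]} => p^`M(i) = 0)).
- by rewrite -mpolyC1 mderivC.
- by move=> p q dp dq; rewrite mderivM dp dq mul0r mulr0 addr0.
- move=> j Pj; have ji : j != i by apply: contraTneq Pj => ->.
  by rewrite mderivX mnm1E (negbTE ji) scale0r.
Qed.

Lemma mderivXU i : ('X_i : {mpoly F[4]})^`M(i) = 1.
Proof.
rewrite mderivX mnm1E eqxx scale1r -mpolyX0; congr mpolyX.
by apply/mnmP => k; rewrite mnmBE subnn mnm0E.
Qed.

Lemma vieta_deriv_eval i x : ((vieta_poly c)^`M(i)).@[x] = vieta_deriv i x.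
Proof.
rewrite /vieta_poly mderivB mderivZ expr2 mderivM (bigD1 i) //= [in X in c *: X](bigD1 i) //=.
have dS : ('X_i + \sum_(j | j != i) 'X_j + 1 : {mpoly F[4]})^`M(i) = 1.
  rewrite !mderivD mderivXU -mpolyC1 mderivC addr0 raddf_sum /= big1 ?addr0 // => j ji.
  by rewrite mderivX mnm1E (negbTE ji) scale0r.
rewrite mderivM mderivXU mderiv_prodX ?eqxx // dS mulr0 addr0 !mul1r mulr1.
rewrite mevalB mevalZ !mevalD meval1 mevalXU rmorph_sum rmorph_prod /=.
under eq_bigr do rewrite mevalXU; under [in X in _ - X]eq_bigr do rewrite mevalXU.
by rewrite /vieta_deriv [in RHS](bigD1 i) //= mulr_natl mulr2n.
Qed.

Lemma vieta_verticesE x :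
  (x \in V) = ((\sum_j x j + 1) ^+ 2 == c * \prod_j x j).
Proof. by rewrite inE vieta_poly_eval subr_eq0. Qed.

Lemma vieta_flipE i x j :
  vieta_flip c i x j = if j == i then x i - vieta_deriv i x else x j.
Proof. by rewrite ffunE vieta_deriv_eval. Qed.

Lemma sum_vieta_flip i x :
  \sum_j vieta_flip c i x j = \sum_j x j - vieta_deriv i x.
Proof.
rewrite (bigD1 i) //= [in RHS](bigD1 i) //= vieta_flipE eqxx addrAC; congr (_ + _ + _).
by apply: eq_bigr => j ji; rewrite vieta_flipE (negbTE ji).
Qed.

Lemma prod_vieta_flip i x :
  \prod_(j | j != i) vieta_flip c i x j = \prod_(j | j != i) x j.
Proof. by apply: eq_bigr => j ji; rewrite vieta_flipE (negbTE ji). Qed.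

(** For a monic quadratic in the i-th variable, the flip is the reflection in its axis at every
    point, solution or not, and the derivative is odd under this reflection. *)
Lemma vieta_deriv_flip i x : vieta_deriv i (vieta_flip c i x) = - vieta_deriv i x.
Proof. by rewrite {1}/vieta_deriv prod_vieta_flip sum_vieta_flip /vieta_deriv; ring. Qed.

Lemma vieta_flipK i : involutive (vieta_flip c i).
Proof.
move=> x; apply/ffunP => j; rewrite !vieta_flipE eqxx vieta_deriv_flip.
by case: eqP => // ->; rewrite opprK subrK.
Qed.

Lemma vieta_flip_vertex i x : (vieta_flip c i x \in V) = (x \in V).
Proof.
rewrite !vieta_verticesE -subr_eq0 -[RHS]subr_eq0; congr (_ == 0).
have prodD1 y : \prod_j y j = y i * \prod_(j | j != i) y j by rewrite (bigD1 i).
rewrite sum_vieta_flip !prodD1 prod_vieta_flip vieta_flipE eqxx /vieta_deriv.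
by ring.
Qed.

Lemma vieta_flip_eq i x : (x == vieta_flip c i x) = (vieta_deriv i x == 0).
Proof.
apply/eqP/eqP => [/ffunP/(_ i)|d0].
  by rewrite vieta_flipE eqxx => /eqP; rewrite -subr_eq0 subKr => /eqP.
by apply/ffunP => j; rewrite vieta_flipE d0 subr0; case: eqP => // ->.
Qed.

Lemma vieta_degreeE x : x \in V -> vieta_degree c x = #|moving_flips x|.
Proof.
move=> xV; rewrite -(card_in_imset (f := fun i => vieta_flip c i x)); last first.
  (* The i-th flip shifts the i-th coordinate by a nonzero amount, whereas the k-th flip with k != i
     leaves it unchanged. *)
  move=> i k; rewrite !inE => di _ /ffunP/(_ i); rewrite !vieta_flipE eqxx.
  case: eqP => // _ /eqP; rewrite eq_sym -subr_eq0 subKr.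
  by rewrite (negbTE di).
apply: eq_card => y; rewrite !inE; apply/andP/imsetP.
  (* Flips are involutions, so both orientations of an edge name the same flip of x. *)
  case=> _ /andP[xy /existsP[i flip_i]]; have yx : y = vieta_flip c i x.
    by case/orP: flip_i => /eqP -> //; rewrite vieta_flipK.
  by exists i; rewrite // inE -vieta_flip_eq -yx.
case=> i; rewrite inE -vieta_flip_eq => xi ->; split.
  by move: xV; rewrite -(vieta_flip_vertex i) inE.
by rewrite /vieta_adj xi; apply/existsP; exists i; rewrite eqxx.
Qed.

Lemma permute_deriv (s : {perm 'I_4}) x i :
  vieta_deriv i (permute s x) = vieta_deriv (s i) x.
Proof.
rewrite /vieta_deriv [in RHS](reindex_inj (@perm_inj _ s)) /=.
rewrite [in X in _ = _ - X](reindex_inj (@perm_inj _ s)) /=.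
congr (2 * (_ + 1) - c * _); first by apply: eq_bigr => j _; rewrite ffunE.
by apply: eq_big => [j|j _]; rewrite ?ffunE // (inj_eq (@perm_inj _ s)).
Qed.

Lemma permute_vertex (s : {perm 'I_4}) x : (permute s x \in V) = (x \in V).
Proof.
rewrite !vieta_verticesE [in RHS](reindex_inj (@perm_inj _ s)) /=.
rewrite [in X in _ = (_ == X)](reindex_inj (@perm_inj _ s)) /=.
by congr ((_ + 1) ^+ 2 == c * _); apply: eq_bigr => j _; rewrite ffunE.
Qed.

Lemma vieta_ndegE (A : {set 'I_4}) :
  vieta_ndeg c #|A| = ('C(4, #|A|) * #|[set x in V | moving_flips x == A]|)%N.
Proof.
rewrite -(card_permute_invariant (P := mem V)) => [|s x|s x i].
- by apply: eq_card => x; rewrite !inE; apply: andb_id2l => xV; rewrite vieta_degreeE // inE.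
- exact: permute_vertex.
- by rewrite !inE permute_deriv.
Qed.

End VietaDegree.

(** * Sums of indicators and sums over four coordinates *)

Section Counting.

Variable F : finFieldType.
Implicit Types (x y z t a b : F) (P C : pred F).
Local Notation q := (#|F|%:R : int).

Lemma sum_indicator P : \sum_x (P x)%:R = \sum_(x | P x) 1%R :> int.
Proof. by rewrite [RHS]big_mkcond; apply: eq_bigr => x _; case: (P x). Qed.

(** This eliminates, or introduces, a summation variable determined by the others. *)
Lemma sum_indicator_eq a C : \sum_x ((x == a) && C x)%:R = (C a)%:R :> int.
Proof.
rewrite (bigD1 a) //= eqxx /= big1 ?addr0 // => x /negbTE ->; by [].
Qed.

Lemma sum_indicator_eq1 a : \sum_x (x == a)%:R = 1%R :> int.
Proof. by rewrite sum_indicator (big_pred1 a). Qed.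

Lemma sum_indicator_and (u : bool) C :
  \sum_x (u && C x)%:R = u%:R * \sum_x (C x)%:R :> int.
Proof.
case: u; first by rewrite mul1r. by rewrite mul0r big1.
Qed.

Lemma sum_indicator_notin (s : seq F) :
  uniq s -> \sum_x (x \notin s)%:R = q - (size s)%:R :> int.
Proof.
move=> us; rewrite sum_indicator sumr_const.
have := cardC (mem s); rewrite (card_uniqP us) => <-.
rewrite natrD addrAC subrr add0r; congr (_ *+ _); apply: eq_card => x; rewrite !inE.
Qed.

Lemma sum_const_int (k : int) : \sum_(x : F) k = q * k.
Proof. by rewrite big_const iter_addr addr0 mulr_natl. Qed.

Definition quad x y z t : {ffun 'I_4 -> F} :=
  [ffun i => nth 0 [:: x; y; z; t] (nat_of_ord i)].

Lemma sum_quad (G : {ffun 'I_4 -> F} -> int) :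
  \sum_w G w = \sum_x \sum_y \sum_z \sum_t G (quad x y z t).
Proof.
rewrite pair_bigA pair_bigA pair_bigA /=.
rewrite (reindex (fun p : F * F * F * F => quad p.1.1.1 p.1.1.2 p.1.2 p.2)) //.
exists (fun w : {ffun 'I_4 -> F} => (w (inord 0), w (inord 1), w (inord 2), w (inord 3)))
  => [[[[x y] z] t]|w] _.
  by rewrite !ffunE !inordK.
apply/ffunP => i; rewrite ffunE /= -[i in RHS]inord_val.
by case: i => -[|[|[|[|//]]]].
Qed.

Lemma sum_quadE x y z t : \sum_i quad x y z t i = x + y + z + t.
Proof. by rewrite !big_ord_recr big_ord0 /= !ffunE /= add0r. Qed.

Lemma prod_quadE x y z t : \prod_i quad x y z t i = x * y * z * t.
Proof. by rewrite !big_ord_recr big_ord0 /= !ffunE /= mul1r. Qed.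

Lemma forall_quad (Q : nat -> F -> bool) x y z t :
  [forall i : 'I_4, Q i (quad x y z t i)] = [&& Q 0%N x, Q 1%N y, Q 2%N z & Q 3%N t].
Proof.
apply/forallP/and4P => [H|[h0 h1 h2 h3] i].
  by have := (H (inord 0), H (inord 1), H (inord 2), H (inord 3)); rewrite !ffunE !inordK //=
    => -[[[]]].
by rewrite ffunE; case: i => -[|[|[|[|//]]]].
Qed.

Lemma forall_prod_quad (Q : nat -> F -> bool) x y z t :
  [forall i : 'I_4, Q i (\prod_(j | j != i) quad x y z t j)]
  = [&& Q 0%N (y * z * t), Q 1%N (x * z * t), Q 2%N (x * y * t) & Q 3%N (x * y * z)].
Proof.
have P i : \prod_(j | j != i) quad x y z t j =
   nth 0 [:: y * z * t; x * z * t; x * y * t; x * y * z] (nat_of_ord i).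
  rewrite big_mkcond !big_ord_recr big_ord0 /= !ffunE /=.
  by case: i => -[|[|[|[|//]]]] /= ?; rewrite ?mul1r ?mulr1.
apply/forallP/and4P => [H|[h0 h1 h2 h3] i].
  by have := (H (inord 0), H (inord 1), H (inord 2), H (inord 3)); rewrite !P !inordK //=
    => -[[[]]].
by rewrite P; case: i => -[|[|[|[|//]]]].
Qed.

End Counting.

(** * Solutions with a prescribed set of moving flips *)

Section VietaPatterns.

Variables (F : finFieldType) (c d : F).
Hypotheses (two_neq0 : (2 : F) != 0) (cd4 : c * d = 4).
Implicit Types (x y z t : F) (w : {ffun 'I_4 -> F}).

Let four_neq0 : (4 : F) != 0 := natr4_neq0 two_neq0.

Let c_neq0 : c != 0.
Proof. by apply: contraNneq four_neq0 => c0; rewrite -cd4 c0 mul0r. Qed.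

Let d_neq0 : d != 0.
Proof. by apply: contraNneq four_neq0 => d0; rewrite -cd4 d0 mulr0. Qed.

(** With S the sum plus 1, the equation S^2 = c xyzt shows that w_i times the i-th derivative is S
    (2 w_i - S), and that w_i != 0 when S != 0. *)
Lemma vieta_deriv_eq0_sum_neq0 i w : w \in vieta_vertices c -> \sum_j w j + 1 != 0 ->
  (vieta_deriv c i w == 0) = (2 * w i == \sum_j w j + 1).
Proof.
rewrite vieta_verticesE /vieta_deriv [X in c * X](bigD1 i) //=.
move: (\sum_j _ + 1) (\prod_(j | _) _) (w i) => s p x /eqP e s0.
have x0 : x != 0.
  by apply: contraNneq s0 => x0; move/eqP: e; rewrite x0 mul0r mulr0 sqrf_eq0.
have E : x * (2 * s - c * p) = s * (2 * x - s).
  by transitivity (2 * x * s - c * (x * p)); [ring | rewrite -e; ring].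
have := mulf_eq0 x (2 * s - c * p); rewrite (negbTE x0) /= => <-.
by rewrite E mulf_eq0 (negbTE s0) subr_eq0.
Qed.

Lemma vieta_deriv_eq0_sum0 i w : \sum_j w j + 1 = 0 ->
  (vieta_deriv c i w == 0) = (\prod_(j | j != i) w j == 0).
Proof.
by move=> s0; rewrite /vieta_deriv s0 mulr0 sub0r oppr_eq0 mulf_eq0 (negbTE c_neq0).
Qed.

Lemma moving_flips_patternE k w : (moving_flips c w == [set i : 'I_4 | (i < k)%N])
  = [forall i : 'I_4, (vieta_deriv c i w != 0) == (i < k)%N].
Proof.
apply/eqP/forallP => [/setP e i|e]; first by have := e i; rewrite !inE => ->.
by apply/setP => i; rewrite !inE; have /eqP -> := e i.
Qed.

(* Solutions with S != 0 and moving flips {i | i < k}, where d = 4/c; as k <= 3 the last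
   coordinate is t = S/2. *)
Definition nonzero_sum_patterns k : int :=
  \sum_(x : F) \sum_(y : F) \sum_(z : F) (let t := x + y + z + 1 in
    [&& t != 0, x * y * z == d * t, (x != t) == (0 < k)%N, (y != t) == (1 < k)%N
      & (z != t) == (2 < k)%N])%:R.

(* Solutions with S = 0 and moving flips {i | i < k}; t is determined by S = 0. *)
Definition zero_sum_patterns k : int :=
  \sum_(x : F) \sum_(y : F) \sum_(z : F) (let t := - (x + y + z + 1) in
    [&& x * y * z * t == 0, (y * z * t != 0) == (0 < k)%N, (x * z * t != 0) == (1 < k)%N,
      (x * y * t != 0) == (2 < k)%N & (x * y * z != 0) == (3 < k)%N])%:R.

(** The fourth flip fixes the solution, so S = 2 t. As 4 = c d, the quartic equation becomes (c t)(d
    t) = (c t)(x y z), and cancelling c t leaves x y z = d t. *)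
Lemma nonzero_sum_patternP k x y z t : (k < 4)%N ->
  [&& x + y + z + t + 1 != 0, (x + y + z + t + 1) ^+ 2 == c * (x * y * z * t),
      (2 * x != x + y + z + t + 1) == (0 < k)%N, (2 * y != x + y + z + t + 1) == (1 < k)%N,
      (2 * z != x + y + z + t + 1) == (2 < k)%N & (2 * t != x + y + z + t + 1) == (3 < k)%N]
  = (t == x + y + z + 1) &&
    [&& t != 0, x * y * z == d * t, (x != t) == (0 < k)%N, (y != t) == (1 < k)%N
      & (z != t) == (2 < k)%N].
Proof.
move=> k4; have -> : (3 < k)%N = false by apply/negbTE; rewrite -leqNgt -ltnS.
rewrite eqbF_neg negbK.
have -> : (2 * t == x + y + z + t + 1) = (t == x + y + z + 1).
  by rewrite -subr_eq0 -[RHS]subr_eq0; congr (_ == 0); ring.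
case: (t =P x + y + z + 1) => [et|_]; last by rewrite !andbF.
have -> : x + y + z + t + 1 = 2 * t by rewrite {2}et et; ring.
rewrite !(inj_eq (mulfI two_neq0)) andbT mulf_eq0 (negbTE two_neq0) /=.
have [//|t0] /= := eqVneq t 0; congr (_ && _).
have -> : ((2 * t) ^+ 2 == c * (x * y * z * t)) = (c * t * (d * t) == c * t * (x * y * z)).
  by rewrite (mulrACA c t d t) cd4; congr (_ == _); ring.
by rewrite (inj_eq (mulfI (mulf_neq0 c_neq0 t0))) eq_sym.
Qed.

Lemma card_moving_flips k : (k < 4)%N ->
  #|[set w in vieta_vertices c | moving_flips c w == [set i : 'I_4 | (i < k)%N]]|%:R
  = nonzero_sum_patterns k + zero_sum_patterns k.
Proof.
move=> k4; rewrite -sumr_const.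
pose s w := \sum_i w i + 1 : F.
transitivity (\sum_w ([&& s w != 0, s w ^+ 2 == c * \prod_i w i
      & [forall i : 'I_4, (2 * w i != s w) == (i < k)%N]]%:R
    + [&& s w == 0, \prod_i w i == 0
      & [forall i : 'I_4, (\prod_(j | j != i) w j != 0) == (i < k)%N]]%:R) : int).
  rewrite big_mkcond; apply: eq_bigr => w _; rewrite inE moving_flips_patternE.
  have := vieta_verticesE c w; rewrite -/(s w).
  have [s0|s0] /= := eqVneq (s w) 0 => wV.
    (* For S = 0 the quartic equation only says that the product of the coordinates vanishes. *)
    rewrite add0r wV s0 expr0n eq_sym mulf_eq0 (negbTE c_neq0) /=.
    by under eq_forallb do rewrite vieta_deriv_eq0_sum0 //; case: (_ && _).
  rewrite addr0 -wV; case: (boolP (w \in _)) => //= wV'.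
  by under eq_forallb do rewrite vieta_deriv_eq0_sum_neq0 //; case: [forall _, _].
rewrite big_split /=; congr (_ + _); rewrite sum_quad.
  apply: eq_bigr => x _; apply: eq_bigr => y _; apply: eq_bigr => z _.
  rewrite -(sum_indicator_eq (x + y + z + 1) (fun t => [&& t != 0, x * y * z == d * t,
    (x != t) == (0 < k)%N, (y != t) == (1 < k)%N & (z != t) == (2 < k)%N])).
  apply: eq_bigr => t _; congr (nat_of_bool _)%:R.
  rewrite /s sum_quadE prod_quadE (forall_quad (fun i x => (2 * x != _) == (i < k)%N)).
  exact: nonzero_sum_patternP.
apply: eq_bigr => x _; apply: eq_bigr => y _; apply: eq_bigr => z _.
rewrite -(sum_indicator_eq (- (x + y + z + 1)) (fun t => [&& x * y * z * t == 0,
  (y * z * t != 0) == (0 < k)%N, (x * z * t != 0) == (1 < k)%N,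
  (x * y * t != 0) == (2 < k)%N & (x * y * z != 0) == (3 < k)%N])).
apply: eq_bigr => t _; congr (nat_of_bool _)%:R.
rewrite /s sum_quadE prod_quadE (forall_prod_quad (fun i x => (x != 0) == (i < k)%N)).
by congr (_ && _); rewrite -[RHS]subr_eq0; congr (_ == 0); ring.
Qed.

End VietaPatterns.

(** * Evaluating the pattern counts *)

Section PatternCounts.

Variables (F : finFieldType) (d : F).
Hypotheses (two_neq0 : (2 : F) != 0) (d_neq0 : d != 0).
Implicit Types (x y z t : F).
Local Notation q := (#|F|%:R : int).

Let is_root x := x ^+ 2 + x + d == 0.
Let r : int := \sum_(x : F) (is_root x)%:R.

Lemma number_of_roots : r = 1 + quad_char (1 - 4 * d).
Proof.
rewrite /r sum_indicator /is_root.
have := sum_quadratic_roots two_neq0 1 d; rewrite expr1n => <-.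
by apply: eq_bigl => x; rewrite mul1r.
Qed.

Let is_root_neq0 x : is_root x -> x != 0.
Proof. by apply: contraTneq => ->; rewrite /is_root expr0n !add0r. Qed.

Let is_root_conj x : is_root (-1 - x) = is_root x.
Proof. by rewrite /is_root; congr (_ == 0); ring. Qed.

Let is_root_conj_neq0 x : is_root x -> -1 - x != 0.
Proof. by rewrite -is_root_conj; exact: is_root_neq0. Qed.

(** At a root x, the discriminant 1 - 4 d equals (2 x + 1)^2, the squared difference of x and its
    conjugate -1 - x. *)
Let is_root_double x : is_root x -> (x == -1 - x) = (4 * d == 1).
Proof.
move=> /eqP rx; rewrite -subr_eq0 -[RHS]subr_eq0.
have -> : x - (-1 - x) = 2 * x + 1 by ring.
have -> : 4 * d - 1 = - (2 * x + 1) ^+ 2.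
  by rewrite -[d](addKr (x ^+ 2 + x)) rx; ring.
by rewrite oppr_eq0 sqrf_eq0.
Qed.

(** The third flip is fixed too, so z = t = x + y + z + 1, that is y = -1 - x. Cancelling z in x y z
    = d z gives x y = d, so x and y are the two roots. *)
Lemma nonzero_sum_patterns_le2 k : (k < 3)%N ->
  nonzero_sum_patterns d k = \sum_(x : F) \sum_(z : F)
   [&& is_root x, z != 0, (x != z) == (0 < k)%N & (-1 - x != z) == (1 < k)%N]%:R.
Proof.
move=> k3; apply: eq_bigr => x _; rewrite exchange_big; apply: eq_bigr => z _ /=.
rewrite -(sum_indicator_eq (-1 - x) (fun y => [&& is_root x, z != 0,
  (x != z) == (0 < k)%N & (y != z) == (1 < k)%N])); apply: eq_bigr => y _.
congr (nat_of_bool _)%:R; have -> : (2 < k)%N = false by apply/negbTE; rewrite -leqNgt -ltnS.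
rewrite eqbF_neg negbK.
have -> : (z == x + y + z + 1) = (y == -1 - x).
  by rewrite eq_sym -subr_eq0 -[RHS]subr_eq0; congr (_ == 0); ring.
case: (y =P -1 - x) => [->|_]; last by rewrite !andbF.
have -> : x + (-1 - x) + z + 1 = z by ring.
rewrite andbT; have [->|z0] /= := eqVneq z 0; first by rewrite andbF.
rewrite (_ : (x * (-1 - x) * z == d * z) = is_root x) //.
by rewrite (inj_eq (mulIf z0)) eq_sym -subr_eq0; congr (_ == 0); ring.
Qed.

(** All coordinates are equal, so the conjugate roots x and y coincide and z = x. *)
Lemma nonzero_sum_patterns0 : nonzero_sum_patterns d 0 = r * (4 * d == 1)%:R.
Proof.
rewrite nonzero_sum_patterns_le2 // mulr_suml; apply: eq_bigr => x _.
rewrite -natrM mulnb -(sum_indicator_eq x (fun z => is_root x && (4 * d == 1))).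
apply: eq_bigr => z _; congr (nat_of_bool _)%:R; rewrite !eqbF_neg !negbK [z == x]eq_sym.
have [<-|_] := eqVneq x z; last by rewrite !andbF.
by case: (boolP (is_root x)) => //= rx; rewrite is_root_neq0 //= eq_sym is_root_double.
Qed.

(** Here z = y = -1 - x differs from x, which requires a simple root. *)
Lemma nonzero_sum_patterns1 : nonzero_sum_patterns d 1 = r * (4 * d != 1)%:R.
Proof.
rewrite nonzero_sum_patterns_le2 // mulr_suml; apply: eq_bigr => x _.
rewrite -natrM mulnb -(sum_indicator_eq (-1 - x) (fun z => is_root x && (4 * d != 1))).
apply: eq_bigr => z _; congr (nat_of_bool _)%:R; rewrite !eqbF_neg !negbK [z == _]eq_sym.
have [<-|_] := eqVneq (-1 - x) z; last by rewrite !andbF.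
by case: (boolP (is_root x)) => //= rx; rewrite is_root_conj_neq0 //= is_root_double // eqb_id andbT.
Qed.

(** For each root x, z ranges over the elements other than 0, x and -1 - x; the last two coincide
    for a double root. *)
Lemma nonzero_sum_patterns2 :
  nonzero_sum_patterns d 2 = r * (q - 3 + (4 * d == 1)%:R).
Proof.
rewrite nonzero_sum_patterns_le2 // mulr_suml; apply: eq_bigr => x _.
rewrite sum_indicator_and; case: (boolP (is_root x)) => [rx|_]; last by rewrite !mul0r.
congr (_ * _); have := is_root_double rx; have [<- <-|nx <-] := eqVneq x (-1 - x).
  transitivity (\sum_z (z \notin [:: 0; x])%:R : int).
    apply: eq_bigr => z _; rewrite !inE negb_or !eqb_id [z == x]eq_sym.
    by case: (z == 0); case: (x == z).
  rewrite sum_indicator_notin /= ?inE ?andbT 1?eq_sym ?is_root_neq0 //; ring.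
transitivity (\sum_z (z \notin [:: 0; x; -1 - x])%:R : int).
  apply: eq_bigr => z _; rewrite !inE !negb_or !eqb_id [z == x]eq_sym [z == -1 - x]eq_sym.
  by case: (z == 0).
rewrite sum_indicator_notin /= ?addr0 // !inE negb_or nx !andbT.
by rewrite ![0 == _]eq_sym is_root_neq0 // is_root_conj_neq0.
Qed.

(** Two distinct triple products involve all four coordinates; if both are nonzero, so is x y z
    t. *)
Lemma zero_sum_patterns_ge2 k : (1 < k)%N -> zero_sum_patterns F k = 0.
Proof.
move=> k1; rewrite /zero_sum_patterns k1 (ltnW k1).
apply: big1 => x _; apply: big1 => y _; apply: big1 => z _ /=.
rewrite !eqb_id !mulf_eq0.
by do 4?case: (_ == 0).
Qed.

(** The pattern means x = 0 and y, z, t != 0, so y != 0 and z avoids 0 and -1 - y. These two values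
    coincide for y = -1, and the count is (q - 1)(q - 2) + 1. *)
Lemma zero_sum_patterns1 : zero_sum_patterns F 1 = q ^+ 2 - 3 * q + 3.
Proof.
transitivity (\sum_(y : F) \sum_(z : F) \sum_(x : F)
    ((x == 0) && ((y != 0) && (z \notin [:: 0; -1 - y])))%:R : int).
  rewrite /zero_sum_patterns exchange_big; apply: eq_bigr => y _.
  rewrite exchange_big; apply: eq_bigr => z _; apply: eq_bigr => x _.
  congr (nat_of_bool _)%:R; rewrite /= !eqb_id !eqbF_neg !negbK !inE !negb_or.
  have [->|x0] := eqVneq x 0; last first.
    rewrite !mulf_eq0 (negbTE x0) /=.
    by do 3?case: (_ == 0).
  rewrite !mul0r !eqxx add0r !mulf_eq0 oppr_eq0 !negb_or /= andbT.
  rewrite -!andbA; congr [&& _, _ & ~~ _].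
  by rewrite -[RHS]subr_eq0; congr (_ == 0); ring.
transitivity (\sum_(y : F) ((y \notin [:: 0])%:R * (q - 2) + ((y == -1) && (y != 0))%:R)).
  apply: eq_bigr => y _; under eq_bigr do rewrite sum_indicator_eq.
  rewrite sum_indicator_and inE; have [->|y0] /= := eqVneq y 0.
    by rewrite !mul0r andbF.
  rewrite !mul1r andbT; have [->|yN1] := eqVneq y (-1).
    rewrite subrr; transitivity (\sum_z (z \notin [:: (0 : F)])%:R : int).
      by apply: eq_bigr => z _; rewrite !inE orbb.
    by rewrite sum_indicator_notin //=; ring.
  rewrite sum_indicator_notin /= ?addr0 // inE andbT eq_sym subr_eq0.
  by rewrite eq_sym.
rewrite big_split /= -mulr_suml sum_indicator_notin //= sum_indicator_eq.
by rewrite oppr_eq0 oner_eq0 /=; ring.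
Qed.

(** All triple products vanish iff at least two coordinates do. This describes six lines with q
    points each in the space S = 0; the four points with three zero coordinates lie on three lines
    each, and 6 q - 12 + 4 = 6 q - 8. The proof sums over x and y instead, according to which of
    them vanish. *)
Lemma zero_sum_patterns0 : zero_sum_patterns F 0 = 6 * q - 8.
Proof.
(* The last summand of the inner count stands for t = 0, since t = -(x + y + z + 1). *)
pose g x y : int := \sum_(z : F) (1 < (x == 0%R) + (y == 0%R) + (z == 0%R)
   + (z == - (x + y + 1))%R)%N%:R.
transitivity (\sum_x \sum_y g x y).
  apply: eq_bigr => x _; apply: eq_bigr => y _; apply: eq_bigr => z _.
  congr (nat_of_bool _)%:R; rewrite /= !eqbF_neg !negbK !mulf_eq0.
  have -> : (- (x + y + z + 1) == 0) = (z == - (x + y + 1)).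
    by rewrite oppr_eq0 -[RHS]subr_eq0; congr (_ == 0); ring.
  by case: (x == 0); case: (y == 0); case: (z == 0); case: (z == _).
have g00 : g 0 0 = q.
  rewrite /g; under eq_bigr do rewrite eqxx /=.
  by rewrite sum_const_int mulr1.
have sum_pair a b : \sum_(z : F) (0 < (z == a) + (z == b))%N%:R = 2%R - (a == b)%:R :> int.
  have [->|ab] := eqVneq a b.
    rewrite -[RHS](sum_indicator_eq1 b); apply: eq_bigr => z _; by case: eqP.
  transitivity (\sum_(z : F) ((z == a)%:R + (z == b)%:R) : int).
    apply: eq_bigr => z _; case: eqP => [->|_]; first by rewrite (negbTE ab).
    by case: eqP.
  by rewrite big_split /= !sum_indicator_eq1.
have g0y y : y != 0 -> g 0 y = 2 - (y == -1)%:R.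
  move=> y0; rewrite -[RHS](_ : 2 - (0 == - (0 + y + 1))%:R = _).
    rewrite -sum_pair; apply: eq_bigr => z _; rewrite eqxx (negbTE y0).
    by congr (nat_of_bool _)%:R; lia.
  by rewrite add0r eq_sym oppr_eq0 addr_eq0.
have gx0 x : x != 0 -> g x 0 = 2 - (x == -1)%:R.
  move=> x0; rewrite -g0y //; apply: eq_bigr => z _.
  by rewrite eqxx addr0 add0r [X in (X + _ + _)%N]addnC.
have gxy x y : x != 0 -> y != 0 -> g x y = (y == -1 - x)%:R.
  move=> x0 y0; transitivity (\sum_(z : F) ((z == 0) && (y == -1 - x))%:R : int);
    last exact: (sum_indicator_eq 0 (fun=> y == -1 - x)).
  apply: eq_bigr => z _; rewrite (negbTE x0) (negbTE y0); congr (nat_of_bool _)%:R.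
  have [->|z0] /= := eqVneq z 0; last by case: eqP.
  rewrite eq_sym oppr_eq0 (_ : (x + y + 1 == 0) = (y == -1 - x)); first by case: eqP.
  by rewrite -[RHS]subr_eq0; congr (_ == 0); ring.
have sumN0 (P : F -> int) : \sum_x P x = P 0 + \sum_(x | x != 0%R) P x by rewrite (bigD1 0).
have cardN0 (k : int) : \sum_(x : F | x != 0%R) k = (q - 1) * k.
  by have := sum_const_int F k; rewrite sumN0 => e; apply: (addrI k); rewrite e; ring.
have sumN1 : \sum_(y : F | y != 0) (2 - (y == -1)%:R) = 2 * (q - 1) - 1.
  rewrite sumrB cardN0 mulrC; congr (_ - _).
  have := sum_indicator_eq1 (-1 : F); rewrite sumN0 eq_sym oppr_eq0 oner_eq0 add0r.
  by [].
rewrite sumN0 (sumN0 (g 0)) g00 (eq_bigr _ g0y) sumN1.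
under [X in _ + X]eq_bigr => x x0.
  rewrite sumN0 gx0 // (eq_bigr _ (fun y => gxy x y x0)).
  have -> : \sum_(y : F | y != 0%R) (y == (-1 - x)%R)%:R = 1%R - (x == (-1)%R)%:R :> int.
    have := sum_indicator_eq1 (-1 - x); rewrite sumN0 eq_sym subr_eq0 [-1 == x]eq_sym.
    by move=> e; apply: (addrI (x == -1)%:R); rewrite e addrC subrK.
  over.
rewrite big_split /= sumN1 sumrB cardN0 mulr1.
have -> : \sum_(x : F | x != 0%R) (x == (-1)%R)%:R = 1%R :> int.
  by have := sum_indicator_eq1 (-1 : F); rewrite sumN0 eq_sym oppr_eq0 oner_eq0 add0r.
by ring.
Qed.

(** The equation is linear in z, namely (x y - d) z = (x + y + 1) d. For its solution, t - x and t -
    y become x (y^2 + y + d) and y (x^2 + x + d) after multiplication by x y - d, so x and y must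
    not be roots. *)
Lemma nonzero_sum_patterns3P x y z (t := x + y + z + 1) :
  [&& t != 0, x * y * z == d * t, x != t, y != t & z != t]
  = (z == (x + y + 1) * d / (x * y - d)) &&
    [&& (x != 0) && ~~ is_root x, y \notin [:: 0; -1 - x; d / x] & ~~ is_root y].
Proof.
rewrite !inE !negb_or; set w := (x + y + 1) * d / _.
have [x0|x0] /= := eqVneq x 0.
  rewrite andbF; apply/negbTE/negP => /and3P[t0 e _]; move/eqP: e.
  by rewrite x0 !mul0r => /esym/eqP; rewrite mulf_eq0 (negbTE d_neq0) (negbTE t0).
have [y0|y0] /= := eqVneq y 0.
  rewrite !andbF; apply/negbTE/negP => /and3P[t0 e _]; move/eqP: e.
  by rewrite y0 mulr0 mul0r => /esym/eqP; rewrite mulf_eq0 (negbTE d_neq0) (negbTE t0).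
have eqE : (x * y * z == d * t) = ((x * y - d) * z == (x + y + 1) * d).
  by rewrite -subr_eq0 -[RHS]subr_eq0 /t; congr (_ == 0); ring.
have zt : (z == t) = (y == -1 - x).
  by rewrite eq_sym -subr_eq0 -[RHS]subr_eq0 /t; congr (_ == 0); ring.
have ydx : (y == d / x) = (x * y - d == 0).
  by rewrite subr_eq0 [x * y]mulrC -(inj_eq (mulIf x0)) divfK.
rewrite eqE zt ydx.
(* If x y = d, the equation forces x + y + 1 = 0, hence z = t, which is excluded; the right side
   excludes y = d/x. *)
have [xyd|xyd] /= := eqVneq (x * y - d) 0.
  rewrite xyd mul0r !andbF [0 == _]eq_sym mulf_eq0 (negbTE d_neq0) orbF.
  have -> : (x + y + 1 == 0) = (y == -1 - x).
    by rewrite -[RHS]subr_eq0; congr (_ == 0); ring.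
  by case: (y == _); rewrite ?andbF.
have -> : ((x * y - d) * z == (x + y + 1) * d) = (z == w).
  have <- : (x * y - d) * w = (x + y + 1) * d by rewrite /w mulrC divfK.
  by rewrite (inj_eq (mulfI xyd)).
have [zw|_] /= := eqVneq z w; last by rewrite !andbF.
have tE : t * (x * y - d) = (x + y + 1) * (x * y).
  by rewrite /t zw /w; field.
have -> : (t != 0) = (y != -1 - x).
  rewrite -[t == 0]orbF -(negbTE xyd) -mulf_eq0 tE !mulf_eq0 (negbTE x0) (negbTE y0) !orbF.
  by rewrite -[in RHS]subr_eq0; congr (_ != 0); ring.
have -> : (x == t) = is_root y.
  rewrite eq_sym -subr_eq0 -[LHS]orbF -(negbTE xyd) -mulf_eq0 mulrBl tE.
  rewrite (_ : _ - _ = x * (y ^+ 2 + y + d)); last by ring.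
  by rewrite mulf_eq0 (negbTE x0).
have -> : (y == t) = is_root x.
  rewrite eq_sym -subr_eq0 -[LHS]orbF -(negbTE xyd) -mulf_eq0 mulrBl tE.
  rewrite (_ : _ - _ = y * (x ^+ 2 + x + d)); last by ring.
  by rewrite mulf_eq0 (negbTE y0).
by case: (y == -1 - x); case: (is_root x); case: (is_root y).
Qed.

(** For each nonzero nonroot x, the excluded y are the r roots and the nonroots 0, -1 - x and d/x.
    These three are distinct except that -1 - x = 0 for x = -1, so the total is (q - 1 - r)(q - 3 -
    r) + 1. *)
Lemma nonzero_sum_patterns3 : nonzero_sum_patterns d 3 = (q - 2 - r) ^+ 2.
Proof.
have sumNroot (L : seq F) : uniq L -> ~~ has is_root L ->
    \sum_y ((y \notin L) && ~~ is_root y)%:R = q - (size L)%:R - r :> int.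
  move=> uL hL; rewrite -sum_indicator_notin // /r -sumrB; apply: eq_bigr => y _.
  case: (boolP (is_root y)) => ry; last by rewrite andbT subr0.
  have -> : y \notin L by apply: contra hL => yL; apply/hasP; exists y.
  by rewrite subrr.
have root0 : is_root 0 = false by rewrite /is_root expr0n !add0r (negbTE d_neq0).
have root_div x : x != 0 -> is_root (d / x) = is_root x.
  move=> x0; rewrite /is_root.
  have -> : (d / x) ^+ 2 + d / x + d = (x ^+ 2 + x + d) * (d / x ^+ 2) by field.
  by rewrite mulf_eq0 [d / _ == 0]mulf_eq0 invr_eq0 sqrf_eq0 (negbTE x0) (negbTE d_neq0) !orbF.
transitivity (\sum_(x : F) (((x \notin [:: 0]) && ~~ is_root x)%:R * (q - 3 - r)
    + ((x == -1) && ((x \notin [:: 0]) && ~~ is_root x))%:R)).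
  apply: eq_bigr => x _.
  transitivity (\sum_y ((x != 0) && ~~ is_root x &&
     ((y \notin [:: 0; -1 - x; d / x]) && ~~ is_root y))%:R : int).
    apply: eq_bigr => y _.
    rewrite -[RHS](sum_indicator_eq ((x + y + 1) * d / (x * y - d))
      (fun z => [&& (x != 0) && ~~ is_root x, y \notin [:: 0; -1 - x; d / x] & ~~ is_root y])).
    by apply: eq_bigr => z _; rewrite -nonzero_sum_patterns3P /= !eqb_id.
  rewrite sum_indicator_and inE; case: (boolP (_ && ~~ is_root x)) => [/andP[x0 rx]|_]; last first.
    by rewrite !mul0r andbF.
  have dx0 : 0 != d / x by rewrite eq_sym mulf_neq0 ?invr_eq0.
  (* Equality would give x (-1 - x) = d and make x a root. *)
  have dxN : -1 - x != d / x.
    apply: contra rx => /eqP e; rewrite /is_root -[d](divfK x0) -e; apply/eqP; ring.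
  rewrite !mul1r andbT; have [xN1|xN1] := eqVneq x (-1).
    transitivity (\sum_y ((y \notin [:: 0; d / x]) && ~~ is_root y)%:R : int).
      by apply: eq_bigr => y _; rewrite !inE xN1 subrr orbA orbb.
    rewrite sumNroot /= ?inE ?dx0 ?root0 ?root_div ?orbF //; ring.
  rewrite sumNroot /= ?addr0 // ?inE ?negb_or ?dx0 ?dxN ?andbT ?root0 ?is_root_conj ?root_div ?rx //.
  by rewrite eq_sym subr_eq0 eq_sym.
rewrite big_split /= -mulr_suml sumNroot //=; last by rewrite root0.
rewrite sum_indicator_eq inE oppr_eq0 oner_eq0 /is_root.
have -> : (-1) ^+ 2 + -1 + d == 0 = false.
  by rewrite sqrrN expr1n subrr add0r (negbTE d_neq0).
rewrite /=; ring.
Qed.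

End PatternCounts.

(** * The number of vertices as a cubic character sum *)

Section VertexCount.

Variables (F : finFieldType) (c d : F).
Hypotheses (two_neq0 : (2 : F) != 0) (cd4 : c * d = 4).
Implicit Types (a b x y z t : F).
Local Notation q := (#|F|%:R : int).

Let four_neq0 : (4 : F) != 0 := natr4_neq0 two_neq0.

Let c_neq0 : c != 0.
Proof. by apply: contraNneq four_neq0 => c0; rewrite -cd4 c0 mul0r. Qed.

Let d_neq0 : d != 0.
Proof. by apply: contraNneq four_neq0 => d0; rewrite -cd4 d0 mulr0. Qed.

(** For b = c x y and a = x + y + 1, the argument is the discriminant of the quartic in t, up to
    square factors none. As a polynomial in z it is b (b - 4) z^2 - 4 a b z, which loses its linear
    term when a = 0. *)
Lemma sum_quad_char_last a b :
  \sum_(z : F) quad_char (b * z * (b * z - 4 * (z + a)))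
  = (q * (a == 0)%:R - 1) * quad_char (b * (b - 4)).
Proof.
have E z : b * z * (b * z - 4 * (z + a)) = b * (b - 4) * z ^+ 2 - 4 * a * b * z by ring.
under eq_bigr do rewrite E.
have [->|b0] := eqVneq b 0.
  by rewrite big1 => [|z _]; rewrite mul0r ?mulr0 ?mul0r ?subr0 quad_char0 ?mulr0.
have [->|a0] := eqVneq a 0; last first.
  rewrite sum_quad_char_quadratic ?mulf_neq0 // mulr0 sub0r mulN1r; by [].
under eq_bigr do rewrite mulr0 !mul0r subr0 mulrC.
rewrite (bigD1 0) //= expr0n mul0r quad_char0 add0r.
under eq_bigr => z z0 do rewrite quad_char_sqrM //.
rewrite mulr1; have := sum_const_int F (quad_char (b * (b - 4))); rewrite (bigD1 0) //= => e.
by apply: (addrI (quad_char (b * (b - 4)))); rewrite e; ring.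
Qed.

(** For x != 0 the argument is quadratic in y with leading coefficient (c x)^2, a nonzero square, so
    the inner sum is -1; for x = 0 it is 0. *)
Lemma sum_quad_char_product :
  \sum_x \sum_y quad_char (c * x * y * (c * x * y - 4)) = 1 - q.
Proof.
transitivity (\sum_(x : F) ((x == 0)%:R - 1 : int)).
  apply: eq_bigr => x _; have [->|x0] := eqVneq x 0.
    by rewrite subrr big1 // => y _; rewrite mulr0 !mul0r quad_char0.
  under eq_bigr => y _.
    rewrite (_ : _ * (_ - _) = (c * x) ^+ 2 * y ^+ 2 - 4 * c * x * y); last by ring.
    over.
  by rewrite sum_quad_char_quadratic ?mulf_neq0 // quad_char_sqr ?mulf_neq0 // sub0r.
by rewrite sumrB sum_indicator_eq1 sum_const_int mulr1.
Qed.

(* The substitution x = 1/(w - 1) turns the quartic x (x + 1) (x^2 + x + d) into a cubic. *)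
Lemma sum_quad_char_quartic :
  1 + \sum_x quad_char (x * (x + 1) * (x ^+ 2 + x + d))
  = quad_char d * \sum_(w : F) quad_char (w * (w ^+ 2 + (d^-1 - 2) * w + 1)).
Proof.
rewrite mulr_sumr [RHS](reindex (fun v => v + 1)) /=; last first.
  by exists (fun w => w - 1) => w _; rewrite ?addrK ?subrK.
(* The term w = 1, missed by the substitution, is the character of d d^-1 = 1 and matches the 1 on
   the left. *)
rewrite [RHS](bigD1 0) //= (bigD1 0) //= mul0r mul0r quad_char0 !add0r; congr (_ + _).
  rewrite mulr1 expr1n mul1r -quad_charM // (_ : d * _ = 1) ?quad_char1 //; field.
  exact: d_neq0.
rewrite [LHS](reindex_inj invr_inj) /=; apply: eq_big => v; first by rewrite invr_eq0.
rewrite invr_eq0 => v0; rewrite -quad_charM //.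
rewrite -[LHS](quad_char_sqrM _ (expf_neq0 2 v0)); congr quad_char; field.
by rewrite v0 d_neq0.
Qed.

Lemma card_vieta_vertices :
  #|vieta_vertices c|%:R = q ^+ 3 - 1
    + quad_char d * (\sum_(w : F) quad_char (w * (w ^+ 2 + (d^-1 - 2) * w + 1))) * q.
Proof.
rewrite -sum_quad_char_quartic -sumr_const big_mkcond /=.
transitivity (\sum_(w : {ffun 'I_4 -> F})
    ((\sum_i w i + 1) ^+ 2 == c * \prod_i w i)%:R : int).
  by apply: eq_bigr => w _; rewrite vieta_verticesE; case: eqP.
rewrite sum_quad.
transitivity (\sum_(x : F) \sum_(y : F)
    (q + (q * (y == -1 - x)%:R - 1) * quad_char (c * x * y * (c * x * y - 4)))).
  apply: eq_bigr => x _; apply: eq_bigr => y _.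
  have qE : q = \sum_(z : F) 1 by rewrite sum_const_int mulr1.
  have -> : (y == -1 - x) = (x + y + 1 == 0).
    by rewrite -[LHS]subr_eq0; congr (_ == 0); ring.
  rewrite -sum_quad_char_last [X in _ = X + _]qE -big_split; apply: eq_bigr => z _ /=.
  pose b := c * x * y * z; pose a := x + y + z + 1.
  transitivity (\sum_(t : F | t ^+ 2 + (2 * a - b) * t + a ^+ 2 == 0) 1 : int).
    rewrite -sum_indicator; apply: eq_bigr => t _; congr (nat_of_bool _)%:R.
    by rewrite sum_quadE prod_quadE -subr_eq0; congr (_ == 0); rewrite /a /b; ring.
  by rewrite sum_quadratic_roots //; congr (1 + quad_char _); rewrite /a /b; ring.
transitivity (q ^+ 3 + q * (\sum_x \sum_y (y == -1 - x)%:R * quad_char (c * x * y * (c * x * y - 4)))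
    - \sum_x \sum_y quad_char (c * x * y * (c * x * y - 4))).
  rewrite mulr_sumr.
  have -> : q ^+ 3 = \sum_(x : F) q ^+ 2 by rewrite sum_const_int; ring.
  rewrite -big_split -sumrB; apply: eq_bigr => x _ /=.
  rewrite mulr_sumr; have -> : q ^+ 2 = \sum_(x : F) q by rewrite sum_const_int; ring.
  by rewrite -big_split -sumrB; apply: eq_bigr => y _ /=; ring.
rewrite sum_quad_char_product.
(* On y = -1 - x, writing 4 = c d turns the argument into c^2 times the quartic x (x + 1)(x^2 + x +
   d). *)
have -> : \sum_x \sum_y (y == -1 - x)%:R * quad_char (c * x * y * (c * x * y - 4))
    = \sum_x quad_char (x * (x + 1) * (x ^+ 2 + x + d)).
  apply: eq_bigr => x _; rewrite (bigD1 (-1 - x)) //= eqxx mul1r big1 ?addr0 => [|y /negbTE ->].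
    rewrite -[RHS](quad_char_sqrM _ c_neq0) -cd4; congr quad_char; ring.
  by rewrite mul0r.
by ring.
Qed.

End VertexCount.

(** * Reduction of the cubic sums to the Jacobsthal sum *)

Section JacobsthalSums.

Variable F : finFieldType.
Hypothesis two_neq0 : (2 : F) != 0.

(** The sum in [card_vieta_vertices] for a = c/4 - 2, which is 0, 2, -6 and 6 for c = 8, 16, -16 and
    32. *)
Definition palindromic_sum (a : F) : int := \sum_(w : F) quad_char (w * (w ^+ 2 + a * w + 1)).

Let jacobsthal : int := \sum_(x : F) quad_char (x ^+ 3 + x).
Let lemniscate : int := \sum_(x : F) quad_char (x ^+ 3 - x).

Lemma palindromic_sum0 : palindromic_sum 0 = jacobsthal.
Proof. by apply: eq_bigr => w _; congr quad_char; ring. Qed.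

(** The cubic is w (w + 1)^2, so only the term w = -1 of the vanishing sum of [quad_char w] is
    lost. *)
Lemma palindromic_sum2 : palindromic_sum 2 = - quad_char (-1 : F).
Proof.
have := sum_quad_char two_neq0; rewrite (bigD1 (-1)) //= => /eqP.
rewrite addrC addr_eq0 => /eqP <-; rewrite /palindromic_sum (bigD1 (-1)) //=.
rewrite (_ : -1 * _ = 0) ?quad_char0 ?add0r; last by ring.
apply: eq_bigr => w wN1; rewrite -[RHS](quad_char_sqrM w (_ : w + 1 != 0)) ?addr_eq0 //.
by congr quad_char; ring.
Qed.

Lemma palindromic_sumN a : palindromic_sum (- a) = quad_char (-1 : F) * palindromic_sum a.
Proof.
rewrite /palindromic_sum mulr_sumr (reindex_inj oppr_inj) /=.
by apply: eq_bigr => w _; rewrite -quad_charM //; congr quad_char; ring.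
Qed.

(** The polynomial x^3 - x is odd. This absorbs the factor [quad_char (-1)] that arises for c = -16
    and c = 32. *)
Lemma lemniscateN : quad_char (-1 : F) * lemniscate = lemniscate.
Proof.
rewrite /lemniscate mulr_sumr [RHS](reindex_inj oppr_inj) /=.
by apply: eq_bigr => w _; rewrite -quad_charM //; congr quad_char; ring.
Qed.

(** The 2-isogeny takes x^3 + x to x (x^2 - 4), and replacing x by 2 x gives 8 (x^3 - x), where 8 is
    2 times a square. *)
Lemma lemniscateE : lemniscate = quad_char (2 : F) * jacobsthal.
Proof.
have -> : jacobsthal = quad_char (2 : F) * lemniscate; last first.
  by rewrite mulrA quad_char_mulss // mul1r.
rewrite -palindromic_sum0 /palindromic_sum sum_quad_char_isogeny ?oner_neq0 //.
rewrite (reindex_inj (mulfI two_neq0)) mulr_sumr; apply: eq_bigr => x _ /=.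
by rewrite -quad_charM // -[RHS](quad_char_sqrM _ two_neq0); congr quad_char; ring.
Qed.

(** The 2-isogeny gives x (x^2 + 12 x + 32) = x (x + 4)(x + 8), and x = 4 (u - 1) turns this into
    8^2 (u^3 - u). *)
Lemma palindromic_sumN6 : palindromic_sum (- 6) = lemniscate.
Proof.
have four_neq0 := natr4_neq0 two_neq0.
have eight_neq0 : (8 : F) != 0 by have := mulf_neq0 two_neq0 four_neq0; rewrite -natrM.
rewrite /palindromic_sum sum_quad_char_isogeny ?oner_neq0 //.
rewrite (reindex (fun u => 4 * (u - 1))) /=; last first.
  by exists (fun x => x / 4 + 1) => x _ /=; field.
apply: eq_bigr => u _; rewrite -[RHS](quad_char_sqrM _ eight_neq0).
by congr quad_char; ring.
Qed.

End JacobsthalSums.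

(** * Degree counts for general c *)

Section DegreeCount.

Variables (F : finFieldType) (c d : F).
Hypotheses (two_neq0 : (2 : F) != 0) (cd4 : c * d = 4).
Local Notation q := (#|F|%:R : int).

Lemma vieta_ndeg_patterns k : (k < 4)%N ->
  (vieta_ndeg c k)%:R
  = 'C(4, k)%:R * (nonzero_sum_patterns d k + zero_sum_patterns F k).
Proof.
move=> k4; rewrite -(card_moving_flips two_neq0 cd4 k4) -natrM.
have cardA : #|[set i : 'I_4 | (i < k)%N]| = k.
  by case: k k4 => [|[|[|[|//]]]] _; rewrite -sum1dep_card big_mkcond !big_ord_recr big_ord0.
by rewrite -[in LHS]cardA vieta_ndegE cardA.
Qed.

(** Here r is the number of roots of w^2 + w + d, and m marks the double root case, which is c =
    16. *)
Lemma vieta_ndegs (r := 1 + quad_char (1 - 4 * d)) (m := (4 * d == 1)%:R : int) :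
  [/\ (vieta_ndeg c 3)%:R = 4 * (q - 2 - r) ^+ 2,
      (vieta_ndeg c 2)%:R = 6 * (r * (q - 3 + m)),
      (vieta_ndeg c 1)%:R = 4 * (r * (1 - m) + (q ^+ 2 - 3 * q + 3))
    & (vieta_ndeg c 0)%:R = r * m + (6 * q - 8)].
Proof.
have d0 : d != 0.
  by apply: contraNneq (natr4_neq0 two_neq0) => d0; rewrite -cd4 d0 mulr0.
rewrite !vieta_ndeg_patterns // nonzero_sum_patterns0 // nonzero_sum_patterns1 //.
rewrite nonzero_sum_patterns2 // nonzero_sum_patterns3 //.
rewrite (@zero_sum_patterns_ge2 _ 3) // (@zero_sum_patterns_ge2 _ 2) //.
rewrite zero_sum_patterns1 zero_sum_patterns0 number_of_roots // -/r -/m !addr0.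
have -> : (4 * d != 1%R)%:R = 1%R - m :> int by rewrite /m; case: eqP.
by split; rewrite // mul1r.
Qed.

End DegreeCount.

(** * The four special values of c *)

Section Census.

Variable F : finFieldType.
Hypothesis two_neq0 : (2 : F) != 0.
Local Notation q := (#|F|%:Z).
Local Notation J := (\sum_(x : F) quad_char (x ^+ 3 + x)).

Let pow2_neq0 n : (2 ^ n)%:R != 0 :> F.
Proof. by rewrite natrX expf_neq0. Qed.

Let four_neq0 : (4 : F) != 0 := pow2_neq0 2.
Let eight_neq0 : (8 : F) != 0 := pow2_neq0 3.

Let natzE n : n%:Z = n%:R. Proof. by rewrite natz. Qed.

Let quad_char_half : quad_char (2^-1 : F) = quad_char (2 : F).
Proof. exact: quad_charV. Qed.

(** Here d = 1/2, the discriminant 1 - 4 d is -1 and the cubic is w^3 + w. *)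
Lemma vieta_census8 :
  [/\ #|vieta_vertices (8 : F)|%:Z = q ^+ 3 - 1 + quad_char (2 : F) * J * q,
      (vieta_ndeg (8 : F) 3)%:Z = 4 * (q - 3 - quad_char (-1 : F)) ^+ 2,
      (vieta_ndeg (8 : F) 2)%:Z = 6 * (1 + quad_char (-1 : F)) * (q - 3),
      (vieta_ndeg (8 : F) 1)%:Z = 4 * (q ^+ 2 - 3 * q + 4 + quad_char (-1 : F))
    & (vieta_ndeg (8 : F) 0)%:Z = 6 * q - 8].
Proof.
have cd : (8 : F) * 2^-1 = 4 by field.
have disc : 1 - 4 * 2^-1 = -1 :> F by field.
have simple : (4 * 2^-1 == 1 :> F) = false.
  by rewrite -subr_eq0 -opprB disc opprK oner_eq0.
rewrite !natzE (card_vieta_vertices two_neq0 cd) quad_char_half invrK subrr.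
have [-> -> -> ->] := vieta_ndegs two_neq0 cd; rewrite disc simple.
by rewrite -/(palindromic_sum 0) palindromic_sum0; split=> /=; ring.
Qed.

(** Here d = 1/4 is a square, the quadratic has a double root and the cubic degenerates. *)
Lemma vieta_census16 :
  [/\ #|vieta_vertices (16 : F)|%:Z = q ^+ 3 - 1 - quad_char (-1 : F) * q,
      (vieta_ndeg (16 : F) 3)%:Z = 4 * (q - 3) ^+ 2,
      (vieta_ndeg (16 : F) 2)%:Z = 6 * (q - 2),
      (vieta_ndeg (16 : F) 1)%:Z = 4 * (q ^+ 2 - 3 * q + 3)
    & (vieta_ndeg (16 : F) 0)%:Z = 6 * q - 7].
Proof.
have cd : (16 : F) * 4^-1 = 4 by field.
have disc : 1 - 4 * 4^-1 = 0 :> F by field.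
have double : (4 * 4^-1 == 1 :> F) by rewrite divff.
rewrite !natzE (card_vieta_vertices two_neq0 cd) quad_charV //.
have -> : quad_char (4 : F) = 1.
  by rewrite (_ : 4 = 2 ^+ 2) ?quad_char_sqr //; ring.
rewrite invrK (_ : 4 - 2 = 2); last by ring.
have [-> -> -> ->] := vieta_ndegs two_neq0 cd; rewrite disc double quad_char0.
by rewrite -/(palindromic_sum 2) palindromic_sum2 //; split=> /=; ring.
Qed.

(** Here d = -1/4 has the character of -1, and the discriminant is 2. *)
Lemma vieta_censusN16 :
  [/\ #|vieta_vertices (-16 : F)|%:Z = q ^+ 3 - 1 + quad_char (2 : F) * J * q,
      (vieta_ndeg (-16 : F) 3)%:Z = 4 * (q - 3 - quad_char (2 : F)) ^+ 2,
      (vieta_ndeg (-16 : F) 2)%:Z = 6 * (1 + quad_char (2 : F)) * (q - 3),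
      (vieta_ndeg (-16 : F) 1)%:Z = 4 * (q ^+ 2 - 3 * q + 4 + quad_char (2 : F))
    & (vieta_ndeg (-16 : F) 0)%:Z = 6 * q - 8].
Proof.
have cd : (-16 : F) * (- 4)^-1 = 4 by field; rewrite oppr_eq0.
have disc : 1 - 4 * (- 4)^-1 = 2 :> F by field; rewrite oppr_eq0.
have simple : (4 * (- 4)^-1 == 1 :> F) = false.
  by rewrite -subr_eq0 -opprB disc oppr_eq0; exact/negbTE.
rewrite !natzE (card_vieta_vertices two_neq0 cd) quad_charV //.
have -> : quad_char (- 4 : F) = quad_char (-1 : F).
  by rewrite -(quad_char_sqrM (-1) two_neq0); congr quad_char; ring.
rewrite invrK (_ : - 4 - 2 = - 6); last by ring.
have [-> -> -> ->] := vieta_ndegs two_neq0 cd; rewrite disc simple.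
rewrite -/(palindromic_sum (- 6)) palindromic_sumN6 // lemniscateN // lemniscateE //.
by split=> /=; ring.
Qed.

(** Here d = 1/8 and the discriminant 1/2 both have the character of 2; the factor from d cancels
    the one in [lemniscateE]. *)
Lemma vieta_census32 :
  [/\ #|vieta_vertices (32 : F)|%:Z = q ^+ 3 - 1 + J * q,
      (vieta_ndeg (32 : F) 3)%:Z = 4 * (q - 3 - quad_char (2 : F)) ^+ 2,
      (vieta_ndeg (32 : F) 2)%:Z = 6 * (1 + quad_char (2 : F)) * (q - 3),
      (vieta_ndeg (32 : F) 1)%:Z = 4 * (q ^+ 2 - 3 * q + 4 + quad_char (2 : F))
    & (vieta_ndeg (32 : F) 0)%:Z = 6 * q - 8].
Proof.
have cd : (32 : F) * 8^-1 = 4 by field.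
have disc : 1 - 4 * 8^-1 = 2^-1 :> F by field; rewrite two_neq0.
have simple : (4 * 8^-1 == 1 :> F) = false.
  by rewrite -subr_eq0 -opprB disc oppr_eq0 invr_eq0; exact/negbTE.
rewrite !natzE (card_vieta_vertices two_neq0 cd) quad_charV //.
have -> : quad_char (8 : F) = quad_char (2 : F).
  by rewrite -(quad_char_sqrM 2 two_neq0); congr quad_char; ring.
rewrite invrK (_ : 8 - 2 = - (- 6)); last by ring.
have [-> -> -> ->] := vieta_ndegs two_neq0 cd; rewrite disc simple quad_char_half.
rewrite -/(palindromic_sum (- - 6)) palindromic_sumN // palindromic_sumN6 //.
rewrite lemniscateN // lemniscateE //.
by rewrite [quad_char 2 * (_ * _)]mulrA quad_char_mulss //; split=> /=; ring.
Qed.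

End Census.

Theorem theorem15p3 (p : nat) (p_prime : prime p) (p_ge5 : (5 <= p)%N) :
  [/\ #|vieta_vertices (8 : 'F_p)|%:Z = p%:Z ^+ 3 - 1 + quad_char (2 : 'F_p) * jacobsthal2_1 p * p%:Z,
      (vieta_ndeg (8 : 'F_p) 3)%:Z = 4 * (p%:Z - 3 - quad_char (-1 : 'F_p)) ^+ 2,
      (vieta_ndeg (8 : 'F_p) 2)%:Z = 6 * (1 + quad_char (-1 : 'F_p)) * (p%:Z - 3),
      (vieta_ndeg (8 : 'F_p) 1)%:Z = 4 * (p%:Z ^+ 2 - 3 * p%:Z + 4 + quad_char (-1 : 'F_p))
    & (vieta_ndeg (8 : 'F_p) 0)%:Z = 6 * p%:Z - 8] /\
  [/\ #|vieta_vertices (16 : 'F_p)|%:Z = p%:Z ^+ 3 - 1 - quad_char (-1 : 'F_p) * p%:Z,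
      (vieta_ndeg (16 : 'F_p) 3)%:Z = 4 * (p%:Z - 3) ^+ 2,
      (vieta_ndeg (16 : 'F_p) 2)%:Z = 6 * (p%:Z - 2),
      (vieta_ndeg (16 : 'F_p) 1)%:Z = 4 * (p%:Z ^+ 2 - 3 * p%:Z + 3)
    & (vieta_ndeg (16 : 'F_p) 0)%:Z = 6 * p%:Z - 7] /\
  [/\ #|vieta_vertices (-16 : 'F_p)|%:Z = p%:Z ^+ 3 - 1 + quad_char (2 : 'F_p) * jacobsthal2_1 p * p%:Z,
      (vieta_ndeg (-16 : 'F_p) 3)%:Z = 4 * (p%:Z - 3 - quad_char (2 : 'F_p)) ^+ 2,
      (vieta_ndeg (-16 : 'F_p) 2)%:Z = 6 * (1 + quad_char (2 : 'F_p)) * (p%:Z - 3),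
      (vieta_ndeg (-16 : 'F_p) 1)%:Z = 4 * (p%:Z ^+ 2 - 3 * p%:Z + 4 + quad_char (2 : 'F_p))
    & (vieta_ndeg (-16 : 'F_p) 0)%:Z = 6 * p%:Z - 8] /\
  [/\ #|vieta_vertices (32 : 'F_p)|%:Z = p%:Z ^+ 3 - 1 + jacobsthal2_1 p * p%:Z,
      (vieta_ndeg (32 : 'F_p) 3)%:Z = 4 * (p%:Z - 3 - quad_char (2 : 'F_p)) ^+ 2,
      (vieta_ndeg (32 : 'F_p) 2)%:Z = 6 * (1 + quad_char (2 : 'F_p)) * (p%:Z - 3),
      (vieta_ndeg (32 : 'F_p) 1)%:Z = 4 * (p%:Z ^+ 2 - 3 * p%:Z + 4 + quad_char (2 : 'F_p))
    & (vieta_ndeg (32 : 'F_p) 0)%:Z = 6 * p%:Z - 8].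
Proof.
have two_neq0 : (2 : 'F_p) != 0.
  by rewrite -(dvdn_pcharf (pchar_Fp p_prime)) gtnNdvd // (leq_trans _ p_ge5).
have cardF : #|'F_p| = p by exact: card_Fp.
have count8 := vieta_census8 two_neq0; have count16 := vieta_census16 two_neq0.
have countN16 := vieta_censusN16 two_neq0; have count32 := vieta_census32 two_neq0.
rewrite cardF in count8 count16 countN16 count32.
split; first exact: count8.
split; first exact: count16.
by split; [exact: countN16 | exact: count32].
Qed.
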